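(* Let $a=\{a_n\}_{n\in\mathbb{N}}$ be a positive, non-increasing, summable sequence with $\sum_{n\ge1}a_n=1$, and let $D_a=\{\sum_{i=k}^\infty a_i : k\in\mathbb{N}\}$. Then for all $\theta\in[0,1]$, $$\overline{\dim}_\theta D_a=\frac{\theta\,\overline{\dim}_{\mathrm B} D_a}{1-(1-\theta)\,\overline{\dim}_{\mathrm B} D_a} \qquad\text{and}\qquad \underline{\dim}_\theta D_a=\frac{\theta\,\underline{\dim}_{\mathrm B} D_a}{1-(1-\theta)\,\underline{\dim}_{\mathrm B} D_a}.$$
   Context: Write $|U|$ for the diameter of $U\subset\mathbb{R}$. For bounded $F\subseteq\mathbb{R}$ and $\theta\in[0,1]$, the lower $\theta$-intermediate dimension $\underline{\dim}_\theta F$ is the infimum of all $s\ge 0$ such that for every $\epsilon>0$ and every $\delta_0>0$ there exist $0<\delta\le\delta_0$ and a cover $\{U_i\}_{i\in I}$ of $F$ with $\delta^{1/\theta}\le |U_i|\le \delta$ for all $i$ and $\sum_{i}|U_i|^s\le\epsilon$. The upper $\theta$-intermediate dimension $\overline{\dim}_\theta F$ is the infimum of all $s\ge 0$ such that for every $\epsilon>0$ there exists $\delta_0>0$ such that for every $0<\delta\le\delta_0$ there is a cover $\{U_i\}_{i\in I}$ of $F$ with $\delta^{1/\theta}\le |U_i|\le \delta$ for all $i$ and $\sum_{i}|U_i|^s\le\epsilon$. Covers are finite or countable. For $\theta=0$ one reads $\delta^{1/\theta}=0$, i.e. there is no lower restriction on the diameters. $\underline{\dim}_{\mathrm B}$ and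 $\overline{\dim}_{\mathrm B}$ denote the lower and upper box-counting dimensions. *)

(* Defs.v *)
From HB Require Import structures.
From mathcomp Require Import all_boot all_order all_algebra.
From mathcomp Require Import all_classical all_reals all_analysis.

Set Implicit Arguments.
Unset Strict Implicit.
Unset Printing Implicit Defensive.

Import Order.TTheory GRing.Theory Num.Theory.
Import numFieldNormedType.Exports.

Local Open Scope classical_set_scope.
Local Open Scope ring_scope.

(* The maximum with 0 only matters for the empty set, whose supremum of
   distances is -oo. *)
Definition diam (R : realType) (U : set R) : \bar R :=
  maxe 0%E (ereal_sup [set (`|x - y|)%:E | x in U & y in U]).

(* delta ^ (1 / theta), read as 0 when theta = 0; the case distinction is
   needed because 0^-1 = 0 would give delta ^ 0 = 1. *)
Definition lower_scale (R : realType) (theta delta : R) : R :=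
  if theta == 0 then 0 else delta `^ theta^-1.

(* The index set I is an arbitrary subset of nat, so that both finite and
   countably infinite covers are allowed. *)
Definition has_theta_cover (R : realType) (F : set R)
    (theta s eps delta : R) : Prop :=
  exists (I : set nat) (U : nat -> set R),
    [/\ F `<=` \bigcup_(i in I) U i,
        forall i, I i ->
          ((lower_scale theta delta)%:E <= diam (U i) <= delta%:E)%E
      & (\esum_(i in I) poweR (diam (U i)) s <= eps%:E)%E].

Definition lower_interm_dim (R : realType) (theta : R) (F : set R) : \bar R :=
  ereal_inf [set s%:E | s in [set s : R | 0 <= s /\
    forall eps : R, 0 < eps -> forall delta0 : R, 0 < delta0 ->
      exists delta : R,
        0 < delta <= delta0 /\ has_theta_cover F theta s eps delta]].

Definition upper_interm_dim (R : realType) (theta : R) (F : set R) : \bar R :=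
  ereal_inf [set s%:E | s in [set s : R | 0 <= s /\
    forall eps : R, 0 < eps -> exists delta0 : R, 0 < delta0 /\
      forall delta : R, 0 < delta <= delta0 ->
        has_theta_cover F theta s eps delta]].

(* The smallest number of sets of diameter at most delta that cover F. *)
Definition covering_number (R : realType) (F : set R) (delta : R) : \bar R :=
  ereal_inf [set (n%:R)%:E | n in [set n : nat |
    exists U : 'I_n -> set R,
      F `<=` \bigcup_(i in setT) U i /\
      forall i, (diam (U i) <= delta%:E)%E]].

Definition box_ratio (R : realType) (F : set R) (delta : R) : \bar R :=
  (lne (covering_number F delta) / (- ln delta)%:E)%E.

Definition lower_box_dim (R : realType) (F : set R) : \bar R :=
  limf_einf (box_ratio F) (0 : R)^'+.

Definition upper_box_dim (R : realType) (F : set R) : \bar R :=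
  limf_esup (box_ratio F) (0 : R)^'+.

(* The decreasing set D_a of tails of the series; sequences are indexed from
   0, so a 0 is the first term. *)
Definition tail_set (R : realType) (a : nat -> R) : set R :=
  range (fun k : nat => limn (fun n : nat => \sum_(k <= i < n) a i)).

(* Main.v *)
Require Import Defs.
From HB Require Import structures.
From mathcomp Require Import all_boot all_order all_algebra.
From mathcomp Require Import all_classical all_reals all_analysis.
From mathcomp Require Import zify ring lra.

Set Implicit Arguments.
Unset Strict Implicit.
Unset Printing Implicit Defensive.

Import Order.TTheory GRing.Theory Num.Theory.
Import numFieldNormedType.Exports.
Local Open Scope classical_set_scope.
Local Open Scope ring_scope.

(** If [theta = 0], singletons give dimension [0].  For [theta > 0] the proof
    compares covers with diameters between [delta^(1/theta)] and [delta] to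
    the covering number [N(r)] at the single scale [r = delta^t], where
    [t = 1 + s (1 - theta) / theta].  Put [b = s / (theta + s (1 - theta))], so
    that [delta^(s/theta) = r^b].  The map [s |-> b] is increasing with inverse
    [b |-> theta b / (1 - (1 - theta) b)], so it is enough to show that a
    cover of small [s]-cost at scale [delta] exists essentially when
    [N(r) <= r^(-b)].

    One direction holds for every set and [s <= 1].  A member of the cover of
    diameter [d] splits into at most [d / r + 1] pieces of diameter [r], and
    the bounds on [d] show that this is at most a multiple of [d^s]; summing
    over a cover of cost at most [1/2] gives [N(r) <= delta^(-s/theta)]
    ([covering_number_of_theta_cover]).  For [s >= 1] there is nothing to
    prove, since the box dimensions of a bounded set of reals are at most [1].

    The other direction uses the shape of the set.  Let [x_k] be its points
    in decreasing order, so that [a_k = x_k - x_(k+1)].  If [N] sets of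
    diameter [r] cover the set, then the sum of all [min (a_k) r] is at most
    [2 r N] ([sum_min_gap]).  Let [n] be the first index with [a_n <= r].  As
    the gaps decrease, this single bound gives both [n <= 2 N] and
    [x_n <= 2 r N] ([cut_at_gap]).  Covering the first [n] points by intervals
    of length [delta^(1/theta)] and the rest by intervals of length [delta]
    costs at most [4 N delta^(s/theta) + delta^s]
    ([theta_cover_of_small_cover]); the exponent [t] is the one that makes
    the two parts of this cover cost the same.

    The upper dimensions quantify over all small scales and the lower ones
    over arbitrarily small scales.  Both quantifiers are stable under the
    change of scale [delta |-> delta^t], and only this is used: the argument
    is carried out once for an abstract [scale_quantifier]
    ([interm_dim_tail]). *)

(** * Diameters and coverings by sets of bounded diameter *)

Lemma dist_le_diam (R : realType) (U : set R) (x y : R) :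
  U x -> U y -> ((`|x - y|)%:E <= diam U)%E.
Proof.
move=> Ux Uy; rewrite /diam le_max; apply/orP; right.
by apply: ereal_sup_ubound; exists x => //; exists y.
Qed.

Lemma diam_le (R : realType) (U : set R) (d : R) : 0 <= d ->
  (forall x y, U x -> U y -> `|x - y| <= d) -> (diam U <= d%:E)%E.
Proof.
move=> d0 dU; rewrite /diam ge_max lee_fin d0 /=.
by apply: ge_ereal_sup => _ [x Ux [y Uy <-]]; rewrite lee_fin dU.
Qed.

Lemma diam_itv (R : realType) (c l : R) : 0 <= l -> diam `[c, c + l] = l%:E.
Proof.
move=> l0; apply/eqP; rewrite eq_le; apply/andP; split.
  by apply: diam_le => // x y; rewrite /= !in_itv/= ler_norml; lra.
have := @dist_le_diam R `[c, c + l] (c + l) c.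
by rewrite addrAC subrr add0r ger0_norm//= !in_itv/= => -> //; lra.
Qed.

Lemma diam_set1 (R : realType) (c : R) : diam [set c] = 0%E.
Proof.
apply/eqP; rewrite eq_le; apply/andP; split; last by rewrite /diam le_max lexx.
by apply: diam_le => // x y -> ->; rewrite subrr normr0.
Qed.

Definition small_cover (R : realType) (F : set R) (r : R) (n : nat) : Prop :=
  exists U : 'I_n -> set R,
    F `<=` \bigcup_(i in setT) U i /\ forall i, (diam (U i) <= r%:E)%E.

Lemma covering_number_le (R : realType) (F : set R) (r : R) (n : nat) :
  small_cover F r n -> (covering_number F r <= (n%:R)%:E)%E.
Proof. by move=> H; apply: ereal_inf_lbound; exists n. Qed.

Lemma covering_number_ltP (R : realType) (F : set R) (r : R) (c : \bar R) :
  (covering_number F r < c)%E ->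
  exists2 n, small_cover F r n & ((n%:R)%:E < c)%E.
Proof. by move=> /ereal_inf_lt [_ [n Hn <-] nc]; exists n. Qed.

Lemma covering_number_ge1 (R : realType) (F : set R) (r : R) :
  F !=set0 -> (1 <= covering_number F r)%E.
Proof.
move=> [x Fx]; apply: le_ereal_inf_tmp => _ [n [U [FU _]] <-].
have [i _ _] := FU _ Fx.
by rewrite lee_fin ler1n (leq_trans _ (ltn_ord i)).
Qed.

Lemma small_coverU (R : realType) (A B : set R) (r : R) (m n : nat) :
  small_cover A r m -> small_cover B r n -> small_cover (A `|` B) r (m + n).
Proof.
move=> [U [AU dU]] [V [BV dV]].
exists (fun i : 'I_(m + n) => match fintype.split i with inl j => U j | inr j => V j end); split.
  move=> x [/AU [j _ Uj]|/BV [j _ Vj]].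
    by exists (lshift n j) => //; rewrite (unsplitK (inl j)).
  by exists (rshift m j) => //; rewrite (unsplitK (inr j)).
by move=> i; case: (fintype.split i).
Qed.

Lemma small_cover_sub (R : realType) (A B : set R) (r : R) (n : nat) :
  A `<=` B -> small_cover B r n -> small_cover A r n.
Proof. by move=> AB [U [BU dU]]; exists U; split=> // x /AB /BU. Qed.

Lemma small_cover0 (R : realType) (r : R) : small_cover (@set0 R) r 0.
Proof. by exists (fun=> set0); split=> // -[]. Qed.

Lemma small_cover_big (R : realType) (s : seq nat) (U : nat -> set R) (r : R)
    (K : nat -> nat) : (forall i, i \in s -> small_cover (U i) r (K i)) ->
  small_cover (\bigcup_(i in [set` s]) U i) r (\sum_(i <- s) K i).
Proof.
elim: s => [|i s IH] H.
  rewrite big_nil; refine (small_cover_sub _ (small_cover0 r)).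
  by move=> x [].
rewrite big_cons; apply: (@small_cover_sub _ _ (U i `|` \bigcup_(i in [set` s]) U i)).
  move=> x [j] /=; rewrite inE => /orP[/eqP ->|js] Uj; first by left.
  by right; exists j.
apply: small_coverU; first by apply: H; rewrite mem_head.
by apply: IH => j js; apply: H; rewrite inE js orbT.
Qed.

(** A set of diameter at most [d] is cut into pieces by the length-[r] grid
    that starts at its infimum. *)
Lemma small_cover_grid (R : realType) (U : set R) (d r : R) :
  0 <= d -> 0 < r -> (diam U <= d%:E)%E ->
  small_cover U r (Num.truncn (d / r)).+1.
Proof.
move=> d0 r0 dU.
have [->|/set0P U0] := eqVneq U set0.
  by exists (fun=> set0); split=> // i; apply: diam_le => //; exact: ltW.
have dist x y : U x -> U y -> `|x - y| <= d.
  by move=> Ux Uy; rewrite -lee_fin; apply: le_trans dU; exact: dist_le_diam.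
have lbU : has_lbound U.
  case: U0 => y Uy; exists (y - d) => x Ux.
  by have := dist _ _ Ux Uy; rewrite ler_norml; lra.
have infU x : U x -> 0 <= x - inf U by move=> Ux; rewrite subr_ge0 ge_inf.
have Uinf x : U x -> x - inf U <= d.
  move=> Ux; rewrite lerBlDr -lerBlDl; apply: lb_le_inf => // y Uy.
  by have := dist _ _ Ux Uy; rewrite ler_norml; lra.
exists (fun i => [set x | U x /\ Num.truncn ((x - inf U) / r) = i]); split.
  move=> x Ux.
  have lt : (Num.truncn ((x - inf U) / r) < (Num.truncn (d / r)).+1)%N.
    by rewrite ltnS le_truncn// ler_pM2r ?invr_gt0// Uinf.
  by exists (Ordinal lt).
move=> i; apply: diam_le; first exact: ltW.
move=> x y [Ux ix] [Uy iy].
have bnd z : U z -> Num.truncn ((z - inf U) / r) = i ->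
    i%:R * r <= z - inf U < i%:R * r + r.
  move=> Uz <-; have /truncn_itv : 0 <= (z - inf U) / r.
    by rewrite divr_ge0// ?infU// ltW.
  by rewrite ler_pdivlMr// ltr_pdivrMr// -(natr1 (Num.truncn _)) (mulrDl _ 1 r) mul1r.
by move: (bnd _ Ux ix) (bnd _ Uy iy); rewrite ler_norml; lra.
Qed.

(** * From covers with restricted diameters to covering numbers *)

Lemma powR_le_base (R : realType) (s x y : R) :
  0 <= s -> 0 <= x -> x <= y -> x `^ s <= y `^ s.
Proof.
by move=> s0 x0 xy; apply: ge0_ler_powR => //; rewrite nnegrE// (le_trans x0).
Qed.

Lemma fset_sum_le_esum (R : realType) (I : set nat) (f : nat -> \bar R)
    (B : seq nat) : uniq B -> [set` B] `<=` I ->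
  (\sum_(i <- B) f i <= \esum_(i in I) f i)%E.
Proof.
move=> uB BI; apply: esum_ge; exists [set` B]; last by rewrite fsbig_seq.
by split=> //; exact: finite_seq.
Qed.

(** The terms of the sum are bounded below by [l `^ s], so a bounded sum has
    finitely many of them.  A set of diameter [d] splits into at most
    [d / r + 1] pieces of diameter [r], and since [l <= d <= delta] both
    summands are multiples of [d `^ s]: [d <= d `^ s * delta `^ (1 - s)] and
    [1 <= d `^ s * l `^ (- s)]. *)
Lemma small_cover_of_power_sum (R : realType) (F : set R) (I : set nat)
    (U : nat -> set R) (l delta s eps r : R) :
  0 < l -> 0 <= s <= 1 -> 0 < r ->
  F `<=` \bigcup_(i in I) U i ->
  (forall i, I i -> (l%:E <= diam (U i) <= delta%:E)%E) ->
  (\esum_(i in I) poweR (diam (U i)) s <= eps%:E)%E ->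
  exists2 n, small_cover F r n &
    n%:R <= eps * (delta `^ (1 - s) / r + l `^ (- s)).
Proof.
move=> l0 /andP[s0 s1] r0 FU dU sumU.
pose d i := fine (diam (U i)).
have dE i : I i -> diam (U i) = (d i)%:E.
  move=> /dU /andP[ld dd]; rewrite /d fineK// fin_numE.
  by apply/andP; split; apply/eqP => E; move: ld dd; rewrite E.
have ld i : I i -> l <= d i by move=> Ii; move: (dU _ Ii); rewrite dE// !lee_fin => /andP[].
have dd i : I i -> d i <= delta by move=> Ii; move: (dU _ Ii); rewrite dE// !lee_fin => /andP[].
have d0 i : I i -> 0 < d i by move=> /ld; exact: lt_le_trans.
have sumB (B : seq nat) : uniq B -> [set` B] `<=` I ->
    \sum_(i <- B) d i `^ s <= eps.
  move=> uB BI; rewrite -lee_fin; apply: le_trans sumU.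
  apply: le_trans (fset_sum_le_esum _ uB BI).
  rewrite -sumEFin big_seq [leRHS]big_seq; apply: lee_sum => i iB.
  by rewrite dE ?poweR_EFin//; exact: BI.
have ls0 : 0 < l `^ s by exact: powR_gt0.
have finI : finite_set I.
  apply: contrapT => infI.
  (* This many terms, each at least [l `^ s], exceed [eps]. *)
  have [B BI sB] := infinite_set_fset (Num.truncn (eps / l `^ s)).+1 infI.
  have uB : uniq (finmap.enum_fset B) by exact: finmap.fset_uniq.
  have := sumB _ uB BI; apply/negP; rewrite -ltNge.
  apply: (@lt_le_trans _ _ ((Num.truncn (eps / l `^ s)).+1%:R * l `^ s)).
    by rewrite -ltr_pdivrMr// truncnS_gt.
  apply: (@le_trans _ _ (\sum_(i <- finmap.enum_fset B) l `^ s)).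
    rewrite big_const_seq count_predT iter_addr_0 -[leRHS]mulr_natl.
    by apply: ler_wpM2r; [exact: ltW|rewrite ler_nat].
  rewrite big_seq [leRHS]big_seq; apply: ler_sum => i iB.
  by apply: powR_le_base; [|exact: ltW|exact: ld (BI _ iB)].
have [B uB IB] : exists2 B : seq nat, uniq B & I = [set` B].
  move/finite_fsetP: finI => [B ->]; exists (finmap.enum_fset B) => //.
  exact: finmap.fset_uniq.
have BI i : i \in B -> I i by rewrite IB.
exists (\sum_(i <- B) (Num.truncn (d i / r)).+1)%N.
  apply: (small_cover_sub FU); rewrite IB; apply: small_cover_big => i iB.
  by apply: small_cover_grid => //; [exact: ltW (d0 _ (BI _ iB))|rewrite dE//; exact: BI].
set C := (X in eps * X).
have C0 : 0 <= C by rewrite addr_ge0// ?divr_ge0// ?powR_ge0// ltW.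
have BI' : [set` B] `<=` I by rewrite IB.
apply: le_trans (ler_wpM2r C0 (sumB _ uB BI')).
rewrite natr_sum mulr_suml big_seq [leRHS]big_seq; apply: ler_sum => i iB.
have Ii := BI _ iB; have di0 := d0 _ Ii.
rewrite -natr1 /C mulrDr lerD//.
  apply: (@le_trans _ _ (d i / r)).
    by rewrite truncn_le divr_ge0// ltW.
  rewrite mulrA ler_pM2r ?invr_gt0//.
  have {1}-> : d i = d i `^ s * d i `^ (1 - s).
    rewrite -powRD ?(gt_eqF di0) ?implybT//.
    by rewrite addrC subrK powRr1// ltW.
  by rewrite ler_wpM2l ?powR_ge0// powR_le_base ?subr_ge0 ?dd// ltW.
by rewrite powRN ler_pdivlMr// mul1r powR_le_base ?ld// ltW.
Qed.

(** For this choice of [r] the two summands of [small_cover_of_power_sum]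
    coincide. *)
Lemma covering_number_of_theta_cover (R : realType) (F : set R)
    (theta s delta : R) : 0 < theta -> 0 <= s <= 1 -> 0 < delta ->
  has_theta_cover F theta s 2^-1 delta ->
  (covering_number F (delta `^ (1 + s * (1 - theta) / theta))
     <= (delta `^ (- (s / theta)))%:E)%E.
Proof.
move=> th0 s01 de0 [I [U [FU dU sumU]]].
set r := delta `^ _.
have r0 : 0 < r by exact: powR_gt0.
have l0 : 0 < delta `^ theta^-1 by exact: powR_gt0.
move: dU; rewrite /lower_scale (gt_eqF th0) => dU.
have [n Fn n_le] := small_cover_of_power_sum l0 s01 r0 FU dU sumU.
apply: le_trans (covering_number_le Fn) _; rewrite lee_fin.
apply: le_trans n_le _.
have -> : delta `^ (1 - s) / r = delta `^ (- (s / theta)).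
  rewrite /r -powRN -powRD ?(gt_eqF de0) ?implybT//; congr (_ `^ _).
  by field; rewrite gt_eqF.
rewrite -powRrM mulrN [theta^-1 * s]mulrC -mulr2n -[X in 2^-1 * X]mulr_natl mulrA.
by rewrite mulVf ?mul1r// pnatr_eq0.
Qed.

(** * The tail set of a summable sequence *)

(** The sums considered have total [1], which makes this the [k]-th tail. *)
Definition tail (R : realType) (a : nat -> R) (k : nat) : R := 1 - series a k.

Lemma tail_setE (R : realType) (a : nat -> R) :
  series a @ \oo --> (1 : R) -> tail_set a = range (tail a).
Proof.
move=> a1; rewrite /tail_set; congr (image _ _); apply/funext => k.
apply: cvg_lim => //.
apply: (@cvg_trans _ ((series a n - series a k) @[n --> \oo])).
  apply: near_eq_cvg; near=> n; rewrite sub_series_geq//.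
  by near: n; exact: nbhs_infty_ge.
by apply: cvgB => //; exact: cvg_cst.
Unshelve. all: by end_near. Qed.

Lemma tailB (R : realType) (a : nat -> R) (m n : nat) : (m <= n)%N ->
  tail a m - tail a n = \sum_(m <= k < n) a k.
Proof.
by move=> mn; rewrite -sub_series_geq// /tail; ring.
Qed.

Section PositiveSummable.
Variables (R : realType) (a : nat -> R).
Hypothesis a_pos : forall n, 0 < a n.
Hypothesis a_sum : series a @ \oo --> (1 : R).

Lemma tail_noninc (m n : nat) : (m <= n)%N -> tail a n <= tail a m.
Proof.
by move=> mn; rewrite -subr_ge0 tailB// sumr_ge0// => i _; exact: ltW.
Qed.

Lemma tail_le (n : nat) (c : R) :
  (forall m, (n <= m)%N -> \sum_(n <= k < m) a k <= c) -> tail a n <= c.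
Proof.
move=> H; rewrite /tail lerBlDr.
have <- : limn (series a) = 1 by exact: cvg_lim a_sum.
apply: limr_le; first by apply/cvg_ex; exists 1.
by exists n => // m /= nm; rewrite -lerBlDr sub_series_geq// H.
Qed.

Lemma tail_ge0 (n : nat) : 0 <= tail a n.
Proof.
rewrite /tail subr_ge0.
have <- : limn (series a) = 1 by exact: cvg_lim a_sum.
apply: nondecreasing_cvgn_le; last by apply/cvg_ex; exists 1.
by move=> m k mk; rewrite -subr_ge0 sub_series_geq// sumr_ge0// => i _; exact: ltW.
Qed.

Lemma tail_le1 (n : nat) : tail a n <= 1.
Proof.
have := tail_noninc (leq0n n); rewrite {2}/tail /series/= big_geq//.
by rewrite subr0.
Qed.

(** The gaps that follow the tails in a set of diameter [r] are disjoint
    intervals which, apart from the last one, lie between two points of the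
    set. *)
Lemma sum_min_gap_piece (P : pred nat) (r : R) (M : nat) : 0 <= r ->
  (forall k m, (k <= m)%N -> P k -> P m -> tail a k - tail a m <= r) ->
  \sum_(0 <= k < M | P k) Num.min (a k) r <= r *+ 2.
Proof.
move=> r0 dP.
have upto (m k : nat) : P m -> (k <= m)%N ->
    \sum_(k <= i < m | P i) Num.min (a i) r <= r.
  move=> Pm; elim: (m - k)%N {-2}k (leqnn (m - k)) => [|d IH] {}k.
    by rewrite leqn0 subn_eq0 => mk _; rewrite big_geq.
  move=> mkd km; have [Pk|nPk] := boolP (P k).
    apply: le_trans (dP _ _ km Pk Pm); rewrite tailB// big_mkcond/=.
    apply: ler_sum => i _; case: ifP => _; last exact: ltW.
    by rewrite ge_min lexx.
  have [mk|km'] := leqP m k; first by rewrite big_geq.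
  by rewrite big_ltn_cond// (negbTE nPk); apply: IH => //; lia.
elim: M => [|M IH]; first by rewrite big_geq// mulrn_wge0.
rewrite big_mkcond big_nat_recr//= -big_mkcond/=.
case: ifP => PM; last by rewrite addr0.
by rewrite mulr2n lerD ?upto// ge_min lexx orbT.
Qed.

(** The full sum is the length of the union of the intervals of length [r]
    that end at the tails, cut off below [0]; each covering set accounts for
    at most [2 * r] of it. *)
Lemma sum_min_gap (r : R) (N M : nat) : 0 <= r ->
  small_cover (range (tail a)) r N ->
  \sum_(0 <= k < M) Num.min (a k) r <= r *+ 2 * N%:R.
Proof.
move=> r0 [U [DU dU]].
have [j Uj] : {j : nat -> 'I_N & forall k, U (j k) (tail a k)}.
  apply: (@choice _ _ (fun k i => U i (tail a k))) => k.
  by have [i _ Ui] := DU (tail a k) (imageT _ _); exists i.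
rewrite (partition_big j xpredT)//=.
rewrite -[X in _ * X%:R](card_ord N) mulr_natr -sumr_const.
apply: ler_sum => i _; apply: sum_min_gap_piece => // k m km /eqP ki /eqP mi.
apply: le_trans (ler_norm _) _; rewrite -lee_fin.
by apply: le_trans (dU i); apply: dist_le_diam; [rewrite -ki|rewrite -mi].
Qed.

(** Cutting the sequence at the first gap of size at most [r], the bound on
    the truncated gaps controls both the number of tails before the cut and
    the length that remains after it. *)
Lemma cut_at_gap (a_noninc : forall m n : nat, (m <= n)%N -> a n <= a m)
    (r : R) (N : nat) : 0 < r ->
  small_cover (range (tail a)) r N ->
  exists2 n : nat, n%:R <= N%:R *+ 2 :> R & tail a n <= r *+ 2 * N%:R.
Proof.
move=> r0 DN.
have sumr M := sum_min_gap M (ltW r0) DN.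
have ex : exists n, a n <= r.
  have a0 : a @ \oo --> (0 : R).
    by apply: cvg_series_cvg_0; apply/cvg_ex; exists 1.
  have [n _ H] : \forall n \near \oo, a n <= r by exact: cvgr_le a0 _ r0.
  by exists n; exact: H n (leqnn n).
case: (ex_minnP ex) => n an n_min.
have before k : (k < n)%N -> Num.min (a k) r = r.
  move=> kn; apply/min_idPr; rewrite leNgt; apply/negP => /ltW /n_min.
  by rewrite leqNgt kn.
have after k : (n <= k)%N -> Num.min (a k) r = a k.
  by move=> nk; apply/min_idPl; apply: le_trans an; exact: a_noninc.
exists n.
  rewrite -(ler_pM2l r0) [leRHS]mulrnAr -[leRHS]mulrnAl; apply: le_trans (sumr n).
  rewrite big_nat (eq_bigr (fun=> r)); last by move=> k /andP[_ /before].
  by rewrite -big_nat sumr_const_nat subn0 mulr_natr.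
apply: tail_le => m nm; apply: le_trans (sumr m).
rewrite [leRHS](big_cat_nat (leq0n n) nm)/= -[leLHS]add0r lerD//.
  by apply: sumr_ge0 => k _; rewrite le_min !ltW.
rewrite big_nat [leRHS]big_nat; apply: ler_sum => k /andP[nk _].
by rewrite after.
Qed.

(** The first [n] tails receive intervals of the smallest admissible length
    [l], and the rest of the set, contained in the interval from [0] to [tail a n], is covered by
    consecutive intervals of the largest admissible length [delta]. *)
Lemma theta_cover_cut (theta s l delta : R) (n : nat) :
  0 < theta -> 0 < delta -> l = delta `^ theta^-1 -> l <= delta ->
  has_theta_cover (range (tail a)) theta s
    (n%:R * l `^ s + (tail a n / delta + 1) * delta `^ s) delta.
Proof.
move=> th0 de0 lE ld; have l0 : 0 < l by rewrite lE powR_gt0.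
pose m := (Num.truncn (tail a n / delta)).+1.
pose c i := if (i < n)%N then tail a i else (i - n)%:R * delta.
pose d i := if (i < n)%N then l else delta.
have d0 i : 0 < d i by rewrite /d; case: ifP.
have dE i : diam `[c i, c i + d i] = (d i)%:E by rewrite diam_itv// ltW.
exists `I_(n + m), (fun i => `[c i, c i + d i]%classic); split.
- move=> _ [k _ <-]; have [kn|nk] := ltnP k n.
    exists k; first by rewrite /= ltn_addr.
    by rewrite /c /d kn /= in_itv/= lexx lerDl ltW.
  have xk0 : 0 <= tail a k / delta by rewrite divr_ge0 ?tail_ge0// ltW.
  pose q := Num.truncn (tail a k / delta).
  exists (n + q)%N.
    rewrite /= ltn_add2l ltnS le_truncn// ler_pM2r ?invr_gt0//.
    exact: tail_noninc.
  rewrite /c /d ltnNge leq_addr /= addKn in_itv/=.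
  have /andP[q1 /ltW q2] := truncn_itv xk0.
  rewrite -ler_pdivlMr// q1/=.
  by rewrite -[X in _ <= _ + X]mul1r -mulrDl natr1 -ler_pdivrMr.
- move=> i _; rewrite dE !lee_fin /lower_scale (gt_eqF th0) -lE /d.
  by case: ifP => _; rewrite ?lexx ?ld.
rewrite (eq_esum (b := fun i => (d i `^ s)%:E)); last first.
  by move=> i _; rewrite dE poweR_EFin.
rewrite esum_fset//; last by move=> i _; rewrite lee_fin powR_ge0.
rewrite -fsbig_ord/= sumEFin lee_fin big_split_ord/= lerD//.
  rewrite (eq_bigr (fun=> l `^ s)); last by move=> i _; rewrite /d ltn_ord.
  by rewrite sumr_const card_ord mulr_natl.
rewrite (eq_bigr (fun=> delta `^ s)); last first.
  by move=> i _; rewrite /d ltnNge leq_addr.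
rewrite sumr_const card_ord -mulr_natl ler_wpM2r ?powR_ge0//.
by rewrite /m -natr1 lerD2r truncn_le divr_ge0 ?tail_ge0// ltW.
Qed.

(** With [r = delta `^ (1 + s * (1 - theta) / theta)] the costs of the two
    parts of the cover agree up to a constant. *)
Lemma theta_cover_of_small_cover
    (a_noninc : forall m n : nat, (m <= n)%N -> a n <= a m)
    (theta s delta : R) (N : nat) :
  0 < theta <= 1 -> 0 < delta <= 1 ->
  small_cover (range (tail a)) (delta `^ (1 + s * (1 - theta) / theta)) N ->
  has_theta_cover (range (tail a)) theta s
    (4 * N%:R * delta `^ (s / theta) + delta `^ s) delta.
Proof.
move=> /andP[th0 th1] /andP[de0 de1].
set r := delta `^ _ => DN.
have r0 : 0 < r by exact: powR_gt0.
have [n n_le xn_le] := cut_at_gap a_noninc r0 DN.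
have ld : delta `^ theta^-1 <= delta.
  by apply: ge1r_powR; rewrite ?de0// invf_ge1.
have [I [U [DU dU sumU]]] := theta_cover_cut s n th0 de0 (erefl _) ld.
exists I, U; split=> //; apply: le_trans sumU _; rewrite lee_fin.
rewrite mulrDl mul1r addrA lerD2r -powRrM [theta^-1 * s]mulrC.
have rE : r * delta `^ s = delta * delta `^ (s / theta).
  rewrite -[X in X * _ `^ (s / theta)]powRr1 ?ltW//.
  rewrite /r -!powRD ?(gt_eqF de0) ?implybT//; congr (_ `^ _).
  by field; rewrite gt_eqF.
set w := delta `^ (s / theta) in rE *.
have w0 : 0 <= w by exact: powR_ge0.
have -> : 4 * N%:R * w = N%:R *+ 2 * w + r *+ 2 * N%:R / delta * delta `^ s.
  have -> : r *+ 2 * N%:R / delta * delta `^ s =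
      2 * N%:R * (r * delta `^ s) / delta by field; rewrite gt_eqF.
  by rewrite rE; field; rewrite gt_eqF.
by rewrite lerD// ler_wpM2r ?powR_ge0// ler_pM2r ?invr_gt0.
Qed.

Lemma small_cover_tail (r : R) : 0 < r ->
  small_cover (range (tail a)) r (Num.truncn r^-1).+1.
Proof.
move=> r0; rewrite -[r^-1]mul1r; apply: small_cover_grid => //.
apply: diam_le => // _ _ [k _ <-] [m _ <-].
have := (tail_ge0 k, tail_le1 k, tail_ge0 m, tail_le1 m).
by move=> [[[? ?] ?] ?]; rewrite ler_norml; lra.
Qed.

End PositiveSummable.

(** * Limits at small scales *)

Section Scales.
Variable R : realType.
Implicit Types (P : R -> Prop) (Q : (R -> Prop) -> Prop).

Definition eventually0 P : Prop :=
  exists d0 : R, 0 < d0 /\ forall d : R, 0 < d <= d0 -> P d.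

Definition frequently0 P : Prop :=
  forall d0 : R, 0 < d0 -> exists d : R, 0 < d <= d0 /\ P d.

(** The common interface of the two quantifiers over small scales: it allows
    the upper and the lower dimensions to be treated together.  The last
    axiom is monotonicity combined with the change of scale [d |-> d `^ t]. *)
Record scale_quantifier Q : Prop := ScaleQuantifier {
  scale_true : Q (fun=> True);
  scale_false : ~ Q (fun=> False);
  scale_powR : forall t P P', 0 < t ->
    eventually0 (fun d => P d -> P' (d `^ t)) -> Q P -> Q P' }.

(** Over [eventually0] such a [B] is the limit superior of [f] at [0], and
    over [frequently0] it is the limit inferior. *)
Definition scale_limit Q (f : R -> \bar R) (B : \bar R) : Prop :=
  (forall c : R, (B < c%:E)%E -> Q (fun d => (f d < c%:E)%E)) /\
  (forall c : R, Q (fun d => (f d <= c%:E)%E) -> (B <= c%:E)%E).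

Lemma eventually0_and P P' : eventually0 P -> eventually0 P' ->
  eventually0 (fun d => P d /\ P' d).
Proof.
move=> [x [x0 Px]] [y [y0 Py]]; exists (Num.min x y).
rewrite lt_min x0 y0; split=> // d; rewrite le_min => /andP[d0 /andP[dx dy]].
by split; [apply: Px|apply: Py]; apply/andP.
Qed.

Lemma eventually0_impl P P' : (forall d, 0 < d -> P d -> P' d) ->
  eventually0 P -> eventually0 P'.
Proof.
move=> PP' [x [x0 Px]]; exists x; split=> // d d0.
by apply: PP'; [case/andP: d0|exact: Px].
Qed.

Lemma eventually0_lt (x : R) : 0 < x -> eventually0 (fun d => d < x).
Proof.
move=> x0; exists (x / 2); split; first by rewrite divr_gt0.
by move=> d; lra.
Qed.

Lemma eventually0_powR_le (p e : R) : 0 < p -> 0 < e ->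
  eventually0 (fun d => d `^ p <= e).
Proof.
move=> p0 e0; exists (e `^ p^-1); split=> [|d /andP[d0 de]].
  exact: powR_gt0.
have -> : e = (e `^ p^-1) `^ p by rewrite -powRrM mulVf ?gt_eqF// powRr1// ltW.
by apply: powR_le_base => //; exact: ltW.
Qed.

Lemma powR_powRV (t d : R) : 0 < t -> 0 < d -> (d `^ t^-1) `^ t = d.
Proof. by move=> t0 d0; rewrite -powRrM mulVf ?gt_eqF// powRr1// ltW. Qed.

Lemma powRV_powR (t d : R) : 0 < t -> 0 < d -> (d `^ t) `^ t^-1 = d.
Proof. by move=> t0 d0; rewrite -powRrM mulfV ?gt_eqF// powRr1// ltW. Qed.

Lemma eventually0_scale : scale_quantifier eventually0.
Proof.
split=> [||t P P' t0 [x [x0 PP']] [y [y0 Py]]]; first by exists 1.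
  by move=> [x [x0 /(_ x)]]; apply; rewrite x0 lexx.
set z := Num.min x y; have z0 : 0 < z by rewrite lt_min x0.
exists (z `^ t); split=> [|d /andP[d0 dz]]; first exact: powR_gt0.
have : 0 < d `^ t^-1 <= z.
  rewrite powR_gt0//= -(powRV_powR t0 z0) powR_le_base ?invr_ge0// ltW//.
rewrite /z le_min => /and3P[e0 ex ey].
by rewrite -(powR_powRV t0 d0); apply: PP'; [|apply: Py]; apply/andP.
Qed.

Lemma frequently0_scale : scale_quantifier frequently0.
Proof.
split=> [x x0||t P P' t0 [x [x0 PP']] HP y y0].
- by exists x; rewrite x0 lexx.
- by move=> /(_ 1 ltr01) [d []].
set z := Num.min x (y `^ t^-1).
have z0 : 0 < z by rewrite lt_min x0 powR_gt0.
have [d [/andP[d0]]] := HP _ z0; rewrite le_min => /andP[dx dy] Pd.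
exists (d `^ t); split; last by apply: PP' => //; apply/andP.
by rewrite powR_gt0//= -[leRHS](powR_powRV t0 y0) powR_le_base// ltW.
Qed.

Lemma scale_impl Q P P' : scale_quantifier Q ->
  eventually0 (fun d => P d -> P' d) -> Q P -> Q P'.
Proof.
move=> SQ PP'; apply: (scale_powR SQ ltr01).
by apply: eventually0_impl PP' => d d0; rewrite powRr1// ltW.
Qed.

Lemma scale_eventually Q P : scale_quantifier Q -> eventually0 P -> Q P.
Proof.
move=> SQ PP; apply: (scale_impl SQ) (scale_true SQ).
by apply: eventually0_impl PP.
Qed.

Lemma nbhs_right0E P : (0 : R)^'+ P <-> eventually0 P.
Proof.
split=> [/nbhs_ballP [e /= e0 eP]|[x [x0 Px]]].
  exists (e / 2); split=> [|d /andP[d0 de]]; first by rewrite divr_gt0.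
  by apply: eP => //=; rewrite /ball/= sub0r normrN gtr0_norm//; lra.
near=> d; apply: Px; apply/andP; split; near: d.
  exact: nbhs_right_gt.
exact: nbhs_right_le.
Unshelve. all: by end_near. Qed.

Lemma limf_esup_scale (f : R -> \bar R) :
  scale_limit eventually0 f (limf_esup f (0 : R)^'+).
Proof.
rewrite limf_esupE; split=> c.
  move=> /ereal_inf_lt [_ [V /nbhs_right0E V0 <-] supV].
  apply: eventually0_impl V0 => d _ Vd; apply: le_lt_trans supV.
  by apply: ereal_sup_ubound; exists d.
move=> /nbhs_right0E fc; apply: ereal_inf_le.
exists (ereal_sup (f @` [set d | (f d <= c%:E)%E])); first by exists [set d | (f d <= c%:E)%E].
by apply: ge_ereal_sup => _ [d /= fd <-].
Qed.

Lemma limf_einf_scale (f : R -> \bar R) :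
  scale_limit frequently0 f (limf_einf f (0 : R)^'+).
Proof.
rewrite limf_einfE; split=> c.
  move=> Bc x x0; apply: contrapT => nf; move: Bc; apply/negP; rewrite -leNgt.
  apply: (@le_trans _ _ (ereal_inf (f @` [set d | 0 < d <= x]))).
    apply: le_ereal_inf_tmp => _ [d /= dx <-]; rewrite leNgt; apply/negP => fd.
    by apply: nf; exists d.
  apply: ereal_sup_ubound; exists [set d | 0 < d <= x] => //.
  by apply/nbhs_right0E; exists x.
move=> fc; apply: ge_ereal_sup => _ [V /nbhs_right0E [x [x0 Vx]] <-].
have [d [dx fd]] := fc _ x0.
by apply: le_trans fd; apply: ereal_inf_lbound; exists d => //; exact: Vx.
Qed.

End Scales.

(** * Box dimensions and covering numbers *)

Lemma box_ratio_le (R : realType) (F : set R) (c r : R) : F !=set0 ->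
  0 < r < 1 ->
  (box_ratio F r <= c%:E)%E = (covering_number F r <= (r `^ (- c))%:E)%E.
Proof.
move=> F0 r01; have ln0 : 0 < - ln r by rewrite oppr_gt0 ln_lt0.
have r0 : 0 < r by case/andP: r01.
rewrite /box_ratio inver (gt_eqF ln0) lee_pdivrMr// -EFinM mulrN -mulNr -ln_powR.
rewrite -lne_EFin ?powR_gt0// lee_lne// in_itv/= leey andbT.
  by apply: le_trans (covering_number_ge1 r F0).
by rewrite lee_fin powR_ge0.
Qed.

Lemma box_ratio_lt (R : realType) (F : set R) (c r : R) : F !=set0 ->
  0 < r < 1 ->
  (box_ratio F r < c%:E)%E = (covering_number F r < (r `^ (- c))%:E)%E.
Proof.
move=> F0 r01; have ln0 : 0 < - ln r by rewrite oppr_gt0 ln_lt0.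
have r0 : 0 < r by case/andP: r01.
rewrite /box_ratio inver (gt_eqF ln0) lte_pdivrMr// -EFinM mulrN -mulNr -ln_powR.
rewrite -lne_EFin ?powR_gt0// lte_lne// in_itv/= leey andbT.
  by apply: le_trans (covering_number_ge1 r F0).
by rewrite lee_fin powR_ge0.
Qed.

Lemma box_ratio_ge0 (R : realType) (F : set R) (r : R) : F !=set0 ->
  0 < r < 1 -> (0 <= box_ratio F r)%E.
Proof.
move=> F0 r01; rewrite /box_ratio mule_ge0// ?lne_ge0 ?covering_number_ge1//.
by rewrite inve_ge0 lee_fin oppr_ge0 ltW// ln_lt0.
Qed.

(** * Intermediate dimensions of the tail set *)

(** Over [eventually0] this unfolds to the upper intermediate dimension, over
    [frequently0] to the lower one. *)
Definition interm_dim (R : realType) (Q : (R -> Prop) -> Prop) (theta : R)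
    (F : set R) : \bar R :=
  ereal_inf [set s%:E | s in [set s : R | 0 <= s /\
    forall eps : R, 0 < eps -> Q (has_theta_cover F theta s eps)]].

Lemma has_theta_cover_le (R : realType) (F : set R) (theta s e e' d : R) :
  e <= e' -> has_theta_cover F theta s e d -> has_theta_cover F theta s e' d.
Proof.
move=> ee' [I [U [FU dU sumU]]]; exists I, U; split=> //.
by apply: le_trans sumU _; rewrite lee_fin.
Qed.

(** Singletons are admissible when there is no lower restriction on the
    diameters. *)
Lemma interm_dim_range0 (R : realType) (Q : (R -> Prop) -> Prop)
    (x : nat -> R) : scale_quantifier Q -> interm_dim Q 0 (range x) = 0%E.
Proof.
move=> SQ; apply/eqP; rewrite eq_le; apply/andP; split; last first.
  by apply: le_ereal_inf_tmp => _ [s [s0 _] <-]; rewrite lee_fin.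
apply/lee_addgt0Pr => s s0; rewrite add0e; apply: ereal_inf_lbound.
exists s => //=; split; first exact: ltW.
move=> e e0; apply: (scale_eventually SQ); exists 1; split=> // d /andP[d0 _].
exists setT, (fun k => [set x k]); split.
- by move=> _ [k _ <-]; exists k.
- by move=> k _; rewrite diam_set1 /lower_scale eqxx lexx lee_fin ltW.
- rewrite esum1 ?lee_fin ?ltW// => k _.
  by rewrite diam_set1 poweR0r// gt_eqF.
Qed.

(** If [r = d `^ (1 + s * (1 - theta) / theta)], then
    [d `^ (s / theta) = r `^ interm_exponent theta s]. *)
Definition interm_exponent (R : realType) (theta s : R) : R :=
  s / (theta + s * (1 - theta)).

Section IntermediateDimension.
Variables (R : realType) (Q : (R -> Prop) -> Prop).
Hypothesis SQ : scale_quantifier Q.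

Lemma box_ratio_limit_ge0 (F : set R) (B : \bar R) : F !=set0 ->
  scale_limit Q (box_ratio F) B -> (0 <= B)%E.
Proof.
move=> F0 [BQ _]; rewrite leNgt; apply/negP => /BQ QB.
apply: (scale_false SQ); apply: (scale_impl SQ) QB.
apply: eventually0_impl (eventually0_lt ltr01) => d d0 d1 rd.
by move: rd; apply/negP; rewrite -leNgt box_ratio_ge0// d0.
Qed.

Section Bounds.
Variables (theta s : R).
Hypotheses (th01 : 0 < theta <= 1) (s0 : 0 <= s).

Let t := 1 + s * (1 - theta) / theta.

Let th0 : 0 < theta. Proof. by case/andP: th01. Qed.

Let t0 : 0 < t.
Proof.
by case/andP: th01 => ? ?; rewrite ltr_wpDr// divr_ge0 ?mulr_ge0 ?subr_ge0// ltW.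
Qed.

Let tE : t * interm_exponent theta s = s / theta.
Proof.
have e : theta + s * (1 - theta) = t * theta.
  by rewrite /t; field; rewrite gt_eqF.
by rewrite /interm_exponent e; field; rewrite !gt_eqF.
Qed.

Lemma box_limit_le_of_covers (F : set R) (B : \bar R) :
  F !=set0 -> scale_limit Q (box_ratio F) B -> s <= 1 ->
  Q (has_theta_cover F theta s 2^-1) ->
  (B <= (interm_exponent theta s)%:E)%E.
Proof.
move=> F0 [_ QB] s1 Qs; apply: QB; apply: (scale_powR SQ t0) Qs.
apply: eventually0_impl (eventually0_lt ltr01) => d d0 d1 cd.
have r01 : 0 < d `^ t < 1.
  have one : 1 = (1 : R) `^ t by rewrite powR1.
  by rewrite powR_gt0//= [ltRHS]one gt0_ltr_powR// nnegrE// ltW.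
rewrite box_ratio_le// -powRrM mulrN tE.
by apply: covering_number_of_theta_cover => //; rewrite s0.
Qed.

(** At the scale [r = d `^ t] the cost [4 * N * d `^ (s / theta) + d `^ s] is
    at most [4 * r `^ (b - c) + r `^ (s / t)], where [b] is the exponent
    attached to [s] and [c < b] bounds the box ratio at [r]. *)
Lemma covers_of_box_limit_lt (a : nat -> R) (B : \bar R) (eps : R) :
  (forall n, 0 < a n) -> (forall m n : nat, (m <= n)%N -> a n <= a m) ->
  series a @ \oo --> (1 : R) ->
  scale_limit Q (box_ratio (range (tail a))) B -> 0 < s ->
  (B < (interm_exponent theta s)%:E)%E -> 0 < eps ->
  Q (has_theta_cover (range (tail a)) theta s eps).
Proof.
move=> a_pos a_noninc a_sum [BQ _] sp Bb e0.
set b := interm_exponent theta s in Bb.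
(* [B] is not yet known to be finite. *)
have [c Bc cb] : exists2 c : R, (B < c%:E)%E & c < b.
  case: B Bb {BQ} => [x| |]//.
    by rewrite lte_fin => xb; exists ((x + b) / 2); rewrite ?lte_fin; lra.
  by move=> _; exists (b - 1); rewrite ?ltNyr//; lra.
have ti0 : 0 < t^-1 by rewrite invr_gt0.
have D0 : range (tail a) !=set0 by exists (tail a 0), 0%N.
(* The box ratio is controlled at [r], so the change of scale goes from [r] to
   [d = r `^ t^-1]. *)
apply: (scale_powR SQ ti0) (BQ _ Bc).
have e8 : 0 < eps / 8 by rewrite divr_gt0.
have e2 : 0 < eps / 2 by rewrite divr_gt0.
have bc0 : 0 < b - c by rewrite subr_gt0.
have st0 : 0 < s / t by rewrite divr_gt0.
apply: eventually0_impl (eventually0_and (eventually0_lt ltr01)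
  (eventually0_and (eventually0_powR_le bc0 e8) (eventually0_powR_le st0 e2))).
move=> r r0 [r1 [r8 r2]] rat.
have [n Dn nr] : exists2 n, small_cover (range (tail a)) r n & n%:R < r `^ (- c).
  have := rat; rewrite box_ratio_lt//; last by rewrite r0.
  by move=> /covering_number_ltP [n Dn]; rewrite lte_fin; exists n.
set d := r `^ t^-1.
have d0 : 0 < d by exact: powR_gt0.
have dt : d `^ t = r by exact: powR_powRV.
have d1 : d <= 1.
  have one : 1 = (1 : R) `^ t^-1 by rewrite powR1.
  by rewrite [leRHS]one powR_le_base// ltW.
rewrite -dt in Dn.
have d01 : 0 < d <= 1 by rewrite d0.
apply: has_theta_cover_le (theta_cover_of_small_cover a_pos a_sum a_noninc th01 d01 Dn).
have -> : d `^ s = r `^ (s / t) by rewrite /d -powRrM mulrC.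
have -> : d `^ (s / theta) = r `^ b by rewrite -tE powRrM dt.
suff : 4 * n%:R * r `^ b <= eps / 2 by lra.
apply: (@le_trans _ _ (4 * (r `^ (- c) * r `^ b))).
  by rewrite -mulrA ler_pM2l// ler_wpM2r ?powR_ge0// ltW.
by rewrite -powRD ?(gt_eqF r0) ?implybT// [- c + b]addrC; lra.
Qed.

End Bounds.

Lemma box_ratio_limit_le1 (a : nat -> R) (B : \bar R) :
  (forall n, 0 < a n) -> series a @ \oo --> (1 : R) ->
  scale_limit Q (box_ratio (range (tail a))) B -> (B <= 1)%E.
Proof.
move=> a_pos a_sum [_ QB]; apply/lee_addgt0Pr => e e0; rewrite -EFinD.
have D0 : range (tail a) !=set0 by exists (tail a 0), 0%N.
apply: QB; apply: (scale_eventually SQ).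
have e2 : 0 < (2 : R)^-1 by rewrite invr_gt0.
apply: eventually0_impl (eventually0_and (eventually0_lt ltr01)
  (eventually0_powR_le e0 e2)) => r r0 [r1 re].
rewrite box_ratio_le//; last by rewrite r0.
apply: le_trans (covering_number_le (small_cover_tail a_pos a_sum r0)) _.
have ri : 1 <= r^-1 by rewrite invf_ge1// ltW.
rewrite lee_fin -natr1; apply: (@le_trans _ _ (2 * r^-1)).
  have : (Num.truncn r^-1)%:R <= r^-1 by rewrite truncn_le invr_ge0 ltW.
  lra.
rewrite powRN powRD ?(gt_eqF r0) ?implybT// powRr1 ?(ltW r0)// invfM.
rewrite mulrC ler_pM2l ?invr_gt0//.
by rewrite -[leLHS]invrK lef_pV2// posrE// ?powR_gt0.
Qed.

(** The map [s |-> interm_exponent theta s] is increasing, with inverse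
    [b |-> theta * b / (1 - (1 - theta) * b)]; it turns the two comparisons
    between [B] and the exponent of [s] into a formula for the infimum of the
    admissible [s].  The values [s >= 1] need no comparison, because [B <= 1]
    makes the right-hand side at most [1]. *)
Lemma interm_dim_tail (a : nat -> R) (B : \bar R) (theta : R) :
  (forall n, 0 < a n) -> (forall m n : nat, (m <= n)%N -> a n <= a m) ->
  series a @ \oo --> (1 : R) -> 0 <= theta <= 1 ->
  scale_limit Q (box_ratio (range (tail a))) B ->
  interm_dim Q theta (range (tail a)) =
    (theta%:E * B / (1 - (1 - theta%:E) * B))%E.
Proof.
move=> a_pos a_noninc a_sum /andP[]; rewrite le_eqVlt => /orP[/eqP <- _ _|th0 th1 QB].
  by rewrite mul0e mul0e interm_dim_range0.
have th01 : 0 < theta <= 1 by rewrite th0.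
have D0 : range (tail a) !=set0 by exists (tail a 0), 0%N.
have := box_ratio_limit_ge0 D0 QB; have := box_ratio_limit_le1 a_pos a_sum QB.
case: B QB => [b| |]// QB; rewrite !lee_fin => b1 b0.
have den0 : 0 < 1 - (1 - theta) * b by nra.
have -> : (theta%:E * b%:E / (1 - (1 - theta%:E) * b%:E) =
           (theta * b)%:E / (1 - (1 - theta) * b)%:E)%E by [].
rewrite inver (gt_eqF den0) -EFinM.
set f := _ / _.
have f0 : 0 <= f by rewrite divr_ge0 ?mulr_ge0// ltW.
have fE : f * (1 - (1 - theta) * b) = theta * b.
  by rewrite /f divfK// gt_eqF.
have expd s : 0 <= s -> 0 < theta + s * (1 - theta).
  by move=> s0; rewrite ltr_wpDr// mulr_ge0// subr_ge0.
apply/eqP; rewrite eq_le; apply/andP; split.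
  apply/lee_addgt0Pr => e e0; rewrite -EFinD; apply: ereal_inf_lbound.
  have s0 : 0 < f + e by rewrite ltr_wpDl.
  exists (f + e) => //=; split; first exact: ltW.
  move=> eps eps0; apply: (@covers_of_box_limit_lt _ _ _ _ a b%:E) => //.
    exact: ltW.
  rewrite lte_fin /interm_exponent ltr_pdivlMr ?expd ?ltW//.
  have : 0 < e * (1 - (1 - theta) * b) by exact: mulr_gt0.
  nra.
apply: le_ereal_inf_tmp => _ [s [s0 Qs] <-]; rewrite lee_fin.
have [s1|s1] := leP s 1; last first.
  apply: le_trans (ltW s1); rewrite /f ler_pdivrMr// mul1r.
  nra.
have h2 : 0 < (2 : R)^-1 by rewrite invr_gt0.
have := box_limit_le_of_covers th01 s0 D0 QB s1 (Qs _ h2).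
rewrite lee_fin /interm_exponent ler_pdivlMr ?expd// => le_s.
by rewrite /f ler_pdivrMr//; nra.
Qed.

End IntermediateDimension.

(* In the extended reals 0^-1 = +oo and 0 * +oo = 0, so that the degenerate
   quotient 0 / 0, which occurs exactly when theta = 0 and the box dimension
   is 1, is read as 0. *)
Theorem theorem4p3 (R : realType) (a : nat -> R)
    (a_pos : forall n, 0 < a n)
    (a_noninc : forall m n : nat, (m <= n)%N -> a n <= a m)
    (a_sum : series a @ \oo --> (1 : R))
    (theta : R) (theta01 : 0 <= theta <= 1) :
  (upper_interm_dim theta (tail_set a) =
     theta%:E * upper_box_dim (tail_set a) /
       (1 - (1 - theta%:E) * upper_box_dim (tail_set a)))%E /\
  (lower_interm_dim theta (tail_set a) =
     theta%:E * lower_box_dim (tail_set a) /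
       (1 - (1 - theta%:E) * lower_box_dim (tail_set a)))%E.
Proof.
rewrite /upper_box_dim /lower_box_dim (tail_setE a_sum); split.
  apply: (interm_dim_tail (eventually0_scale R)) => //; exact: limf_esup_scale.
apply: (interm_dim_tail (frequently0_scale R)) => //; exact: limf_einf_scale.
Qed.
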